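(* If an integral domain $D$ is condensed and a $\ast$-domain, then $D$ is a pre-Schreier domain.
   Context: Let $D$ be an integral domain. For nonzero ideals $I,J$ of $D$, the product $IJ$ is condensed if $IJ=\{ij : i\in I,\ j\in J\}$; $D$ is condensed if $IJ$ is condensed for every pair of nonzero ideals $I,J$. $D$ is a $\ast$-domain if for every pair $\{a_i\}_{i=1}^m,\{b_j\}_{j=1}^n$ of finite sets of nonzero elements of $D$ one has $\left(\bigcap_i (a_i)\right)\left(\bigcap_j (b_j)\right)=\bigcap_{i,j}(a_ib_j)$, where $(a)=aD$. An element $x\in D\setminus\{0\}$ is primal if for all $y,z\in D\setminus\{0\}$, $x\mid yz$ implies $x=rs$ with $r\mid y$ and $s\mid z$. $D$ is pre-Schreier if every nonzero element of $D$ is primal. *)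

(* Defs.v *)
From mathcomp Require Import all_boot all_order all_algebra.
From mathcomp Require Import classical_sets.

Set Implicit Arguments.
Unset Strict Implicit.
Unset Printing Implicit Defensive.

Import GRing.Theory.
Local Open Scope classical_set_scope.
Local Open Scope ring_scope.

(* MathComp's [idealr] covers only proper ideals with a boolean membership
   test; here an ideal is an arbitrary subset, and the unit ideal is allowed. *)
Definition is_ideal (D : idomainType) (I : set D) : Prop :=
  [/\ I 0,
      forall x y, I x -> I y -> I (x + y)
    & forall d x, I x -> I (d * x)].

Definition is_nonzero_ideal (D : idomainType) (I : set D) : Prop :=
  is_ideal I /\ exists2 x, I x & x != 0.

Definition principal (D : idomainType) (a : D) : set D :=
  [set a * d | d in [set: D]].

(* The set of all finite sums of products i * j with i in I and j in J. *)
Definition ideal_mul (D : idomainType) (I J : set D) : set D :=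
  [set x | exists n (u v : 'I_n -> D),
     [/\ forall k, I (u k), forall k, J (v k) & x = \sum_(k < n) u k * v k]].

Definition condensed_mul (D : idomainType) (I J : set D) : Prop :=
  ideal_mul I J = [set i * j | i in I & j in J].

Definition condensed (D : idomainType) : Prop :=
  forall I J : set D,
    is_nonzero_ideal I -> is_nonzero_ideal J -> condensed_mul I J.

(* The families are nonempty: with an empty one, every nonzero element
   would be forced to be a unit. *)
Definition star_domain (D : idomainType) : Prop :=
  forall (m n : nat) (a : 'I_m -> D) (b : 'I_n -> D),
    (0 < m)%N -> (0 < n)%N ->
    (forall i, a i != 0) -> (forall j, b j != 0) ->
    ideal_mul (\bigcap_(i : 'I_m) principal (a i))
              (\bigcap_(j : 'I_n) principal (b j))
    = \bigcap_(i : 'I_m) \bigcap_(j : 'I_n) principal (a i * b j).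

Definition divides (D : idomainType) (x y : D) : Prop := exists d, y = x * d.

Definition primal (D : idomainType) (x : D) : Prop :=
  forall y z : D, y != 0 -> z != 0 -> divides x (y * z) ->
    exists r s : D, [/\ x = r * s, divides r y & divides s z].

Definition pre_schreier (D : idomainType) : Prop :=
  forall x : D, x != 0 -> primal x.

(* Main.v *)
Require Import Defs.
From mathcomp Require Import all_boot all_order all_algebra.
From mathcomp Require Import classical_sets.
From mathcomp Require Import ring.

Import GRing.Theory.
Local Open Scope classical_set_scope.
Local Open Scope ring_scope.

(** If x divides yz, then xyz lies in (x^2) ∩ (xz) ∩ (yx) ∩ (yz), which by the
    ∗-property is the product of (x) ∩ (y) and (x) ∩ (z).  Condensedness writes
    xyz = (y s)(z r) with x | y s and x | z r; cancelling yz gives x = r s, and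
    then r s | y s and r s | z r give r | y and s | z. *)

Lemma principalP (D : idomainType) (a x : D) : principal a x <-> divides a x.
Proof. by split=> [[d _ <-]|[d ->]]; exists d. Qed.

Lemma is_ideal_principal (D : idomainType) (a : D) : is_ideal (principal a).
Proof.
split=> [|_ _ [d _ <-] [e _ <-]|d _ [e _ <-]].
- by exists 0; rewrite ?mulr0.
- by exists (d + e); rewrite ?mulrDr.
- by exists (d * e); rewrite // mulrCA.
Qed.

Lemma is_ideal_bigcap (D : idomainType) (T : Type) (I : T -> set D) :
  (forall t, is_ideal (I t)) -> is_ideal (\bigcap_t I t).
Proof.
move=> idI; split=> [t _|x y Ix Iy t _|d x Ix t _]; case: (idI t) => I0 ID IM.
- exact: I0.
- by apply: ID; [apply: Ix | apply: Iy].
- by apply: IM; apply: Ix.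
Qed.

(** The product of all the [a i] is a common multiple, with the product of the other factors as
    cofactor at [i], and it is nonzero because [D] is a domain. *)
Lemma bigcap_principal_nonzero_ideal (D : idomainType) (n : nat)
    (a : 'I_n -> D) :
  (forall i, a i != 0) -> is_nonzero_ideal (\bigcap_i principal (a i)).
Proof.
move=> a0; split; first by apply: is_ideal_bigcap => i; apply: is_ideal_principal.
exists (\prod_i a i); last by apply/prodf_neq0.
by move=> i _; exists (\prod_(j | j != i) a j); rewrite // [RHS](bigD1 i).
Qed.

Theorem proposition3 (D : idomainType) :
  condensed D -> star_domain D -> pre_schreier D.
Proof.
move=> condD starD x x0 y z y0 z0 [t yzE].
(* Encodes the generators of (u) ∩ (v) as a family on ['I_2]: [ord0] selects [u], [ord_max] selects
   [v]. *)
pose pair (u v : D) (i : 'I_2) := if i == ord0 then u else v.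
have pair_neq0 u v : u != 0 -> v != 0 -> forall i, pair u v i != 0.
  by move=> u0 v0 i; rewrite /pair; case: ifP.
have nzI := bigcap_principal_nonzero_ideal _ _ _ (pair_neq0 _ _ x0 y0).
have nzJ := bigcap_principal_nonzero_ideal _ _ _ (pair_neq0 _ _ x0 z0).
have := starD 2 2 _ _ isT isT (pair_neq0 _ _ x0 y0) (pair_neq0 _ _ x0 z0).
rewrite (condD _ _ nzI nzJ) => prodE.
have : (\bigcap_i \bigcap_j principal (pair x y i * pair x z j)) (x * (y * z)).
  move=> i _ j _; apply/principalP; rewrite /pair.
  (* The generators come in the order x^2, xz, yx, yz. Divisibility by x^2 is where x | yz enters,
     with cofactor [t]; for the others the cofactor is the factor of xyz left over. *)
  case: (i == ord0); case: (j == ord0).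
  - by exists t; rewrite yzE mulrA.
  - by exists y; ring.
  - by exists z; ring.
  - by exists x; ring.
rewrite -prodE => -[i Ii [j Jj ijE]].
(* Both divisors of each factor are recorded: i = xc = ys here, and j = xd = zr next. *)
have [/principalP [c ixc] /principalP [s iys]] := (Ii ord0 I, Ii ord_max I).
have [/principalP [d jxd] /principalP [r jzr]] := (Jj ord0 I, Jj ord_max I).
rewrite /pair /= in ixc iys jxd jzr.
have xE : x = r * s.
  have yz0 : y * z != 0 by rewrite mulf_neq0.
  apply: (mulIf yz0); rewrite -ijE iys jzr; ring.
have rs0 : r * s != 0 by rewrite -xE.
have [r0 s0] : r != 0 /\ s != 0 by move: rs0; rewrite mulf_eq0 negb_or => /andP.
exists r, s; split=> //.
(* Substituting x = rs in ys = xc and cancelling s leaves y = rc; likewise zr = xd gives z = sd. *)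
- by exists c; apply: (mulIf s0); rewrite -iys ixc xE; ring.
- by exists d; apply: (mulIf r0); rewrite -jzr jxd xE; ring.
Qed.
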